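(* Let $\beta\in[0,1]$, $m>0$, $\sigma\ge0$, and let $C=C(\beta,m,\sigma)$ be the constant of the modified log-Sobolev inequality for convex functions recalled in the context. Let $X_1,\dots,X_n$ be independent real random variables whose laws all belong to $\mathcal{M}_\beta(m,\sigma^{\beta+1})$, let $X=(X_1,\dots,X_n)$, and let $\varphi\colon\mathbb{R}^n\to\mathbb{R}$ be a smooth convex Lipschitz function. Then, for $\beta\in(0,1]$ and all $t\ge0$, $$\mathbb{P}\big(\varphi(X)\ge\mathbb{E}\varphi(X)+t\big)\le\exp\Big(-\frac{3}{16}\min\Big\{\frac{t^2}{C\sup|\nabla\varphi|^2},\frac{t^{1+\beta}}{C^\beta\sup\|\nabla\varphi\|_{(\beta+1)/\beta}^{1+\beta}}\Big\}\Big).$$ If $\beta=0$, then for all $t\ge0$, $$\mathbb{P}\big(\varphi(X)\ge\mathbb{E}\varphi(X)+t\big)\le\exp\Big(-\frac14\min\Big\{\frac{t^2}{C\sup|\nabla\varphi|^2},\frac{t}{(m+3\sigma)\sup\|\nabla\varphi\|_\infty}\Big\}\Big).$$ The suprema are over all points of $\mathbb{R}^n$.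
   Context: For $\beta\in[0,1]$, $m>0$, $\sigma\ge 0$, $\mathcal{M}_\beta(m,\sigma^{\beta+1})$ denotes the class of probability measures $\mu$ on $\mathbb{R}$ such that $$\forall_{x\ge m}\ \ \nu^+([x,\infty))\le\sigma^{\beta+1}\mu([x,\infty)),\qquad \forall_{x\le -m}\ \ \nu^-((-\infty,x])\le\sigma^{\beta+1}\mu((-\infty,x]),$$ where $\nu^+$ is the measure on $[m,\infty)$ with (Lebesgue) density $x^\beta\mu([x,\infty))$ and $\nu^-$ is the measure on $(-\infty,-m]$ with density $|x|^\beta\mu((-\infty,x])$. The constant $C=C(\beta,m,\sigma)\in(0,\infty)$ is a constant, depending only on $\beta,m,\sigma$, such that for every $n\ge1$, all independent $X_1,\dots,X_n$ with laws in $\mathcal{M}_\beta(m,\sigma^{\beta+1})$ (write $X=(X_1,\dots,X_n)$) and every smooth convex $\psi\colon\mathbb{R}^n\to\mathbb{R}$: - if $\beta\in(0,1]$, $\operatorname{Ent}e^{\psi(X)}\le C\,\mathbb{E}\big[\big(|\nabla\psi(X)|^2\vee\|\nabla\psi(X)\|_{(\beta+1)/\beta}^{(\beta+1)/\beta}\big)e^{\psi(X)}\big]$; - if $\beta=0$ and $|\partial_i\psi|\le 1/(2(m+3\sigma))$ everywhere for all $i$, $\operatorname{Ent}e^{\psi(X)}\le C\,\mathbb{E}\big[|\nabla\psi(X)|^2e^{\psi(X)}\big]$. (Such a constant exists by a theorem of the same paper.) Here $\operatorname{Ent}Y=\mathbb{E}Y\log Y-\mathbb{E}Y\log\mathbb{E}Y$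 if $\mathbb{E}Y\log Y<\infty$ and $\operatorname{Ent}Y=\infty$ otherwise; $\|\cdot\|_p$ is the $\ell_p^n$ norm and $|\cdot|=\|\cdot\|_2$. *)

(* Defs.v *)
From mathcomp Require Import all_boot all_order all_algebra.
From mathcomp Require Import all_classical all_reals all_analysis.

Set Implicit Arguments.
Unset Strict Implicit.
Unset Printing Implicit Defensive.

Import Order.TTheory GRing.Theory Num.Theory.
Import numFieldNormedType.Exports.

Local Open Scope classical_set_scope.
Local Open Scope ring_scope.

Section calculus.
Context {R : realType} {n : nat}.
Implicit Types (f : 'rV[R]_n -> R) (x v : 'rV[R]_n).

Definition partial (i : 'I_n) f : 'rV[R]_n -> R :=
  fun x => 'D_(delta_mx ord0 i) f x.

Definition iter_partial (s : seq 'I_n) f : 'rV[R]_n -> R := foldr partial f s.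

(* C^oo: every iterated partial derivative exists everywhere and is
   continuous. *)
Definition smooth f : Prop :=
  forall s : seq 'I_n,
    (forall (i : 'I_n) x, derivable (iter_partial s f) x (delta_mx ord0 i)) /\
    continuous (iter_partial s f).

Definition grad f x : 'rV[R]_n := \row_i partial i f x.

(* The l_p^n norm for 0 < p < oo. The l_oo^n norm is the library norm `|v| of
   a row vector (lemma mx_normrE), which is also the norm used by
   "lipschitz". *)
Definition lpnorm (p : R) v : R := (\sum_i `|v ord0 i| `^ p) `^ p^-1.

Definition l2norm v : R := lpnorm 2 v.

(* Extended-real valued, so that no boundedness is presupposed. *)
Definition supE (g : 'rV[R]_n -> R) : \bar R := ereal_sup (range (EFin \o g)).

End calculus.

Section tail_class.
Context {R : realType}.
Implicit Types (beta m s : R) (mu : probability R R).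

Definition nu_plus beta m mu (A : set R) : \bar R :=
  (\int[lebesgue_measure]_(y in A `&` `[m, +oo[)
     ((y `^ beta)%R%:E * mu [set` `[y, +oo[]))%E.

Definition nu_minus beta m mu (A : set R) : \bar R :=
  (\int[lebesgue_measure]_(y in A `&` `]-oo, (- m)%R])
     ((`|y| `^ beta)%R%:E * mu [set` `]-oo, y]]))%E.

(* The class M_beta(m, s); it is used with s = sigma^(beta+1). *)
Definition tail_class beta m s mu : Prop :=
  (forall x : R, m <= x ->
     (nu_plus beta m mu [set` `[x, +oo[] <= s%:E * mu [set` `[x, +oo[])%E) /\
  (forall x : R, x <= - m ->
     (nu_minus beta m mu [set` `]-oo, x]] <= s%:E * mu [set` `]-oo, x]])%E).

End tail_class.

Section random_vectors.
Context {d : measure_display} {T : measurableType d} {R : realType}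
  (P : probability T R).

Definition mutually_independent (n : nat) (X : 'I_n -> {RV P >-> R}) : Prop :=
  forall (J : {set 'I_n}) (A : 'I_n -> set R),
    (forall i, measurable (A i)) ->
    P (\bigcap_(i in [set` J]) (X i @^-1` A i)) =
    (\prod_(i in J) fine (P (X i @^-1` A i)))%:E.

Definition rvec (n : nat) (X : 'I_n -> {RV P >-> R}) (w : T) : 'rV[R]_n :=
  \row_i X i w.

(* For a positive random variable Y. On the first branch E[Y] is finite. *)
Definition Ent (Y : T -> R) : \bar R :=
  (let EYlnY := 'E_P[fun w => (Y w * ln (Y w))%R] in
   if EYlnY < +oo then EYlnY - 'E_P[Y] * lne 'E_P[Y] else +oo)%E.

End random_vectors.

(* C is a constant, good for all dimensions and all laws in the class, in the
   modified log-Sobolev inequality for smooth convex functions. *)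
Definition mlsi_constant (R : realType) (beta m sigma C : R) : Prop :=
  0 < C /\
  forall (n : nat) (d : measure_display) (T : measurableType d)
    (P : probability T R) (X : 'I_n -> {RV P >-> R}) (psi : 'rV[R]_n -> R),
    (0 < n)%N ->
    mutually_independent X ->
    (forall i, tail_class beta m (sigma `^ (beta + 1)) (distribution P (X i))) ->
    smooth psi ->
    convex_function setT psi ->
    (0 < beta ->
      let q := (beta + 1) / beta in
      (Ent P (fun w => expR (psi (rvec X w))) <=
       C%:E * 'E_P[fun w =>
         (Num.max (l2norm (grad psi (rvec X w)) ^+ 2)
                  (lpnorm q (grad psi (rvec X w)) `^ q)
          * expR (psi (rvec X w)))%R])%E) /\
    (beta = 0 ->
      (forall i x, `|partial i psi x| <= 1 / (2 * (m + 3 * sigma))) ->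
      (Ent P (fun w => expR (psi (rvec X w))) <=
       C%:E * 'E_P[fun w =>
         (l2norm (grad psi (rvec X w)) ^+ 2 * expR (psi (rvec X w)))%R])%E).

(* Main.v *)
Require Import Defs.
From mathcomp Require Import all_boot all_order all_algebra.
From mathcomp Require Import all_classical all_reals all_analysis.
From mathcomp Require Import measurable_realfun ring lra.

Set Implicit Arguments.
Unset Strict Implicit.
Unset Printing Implicit Defensive.

Import Order.TTheory GRing.Theory Num.Theory.
Import numFieldNormedType.Exports.

Local Open Scope classical_set_scope.
Local Open Scope ring_scope.

(** Herbst's argument.  Apply the modified log-Sobolev inequality to [l phi]
    for [0 < l <= l0]: while the gradient term is at most [A l^2 / C], it reads
    [l F'(l) - F(l) ln F(l) <= A l^2 F(l)] for [F(l) = E exp(l phi(X))], that is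
    [(ln F(l) / l)' <= A].  Hence [ln F(l0) <= l0 E phi(X) + A l0^2], and
    Chernoff's bound with [A = t / (2 l0)] gives the tail [exp(- l0 t / 2)]; the
    slope [l0] is then taken as large as the gradient bounds allow.
    Exponential integrability of [phi(X)], without which neither [F] nor
    [E phi(X)] makes sense, comes from the tail condition: it forces
    [P(|X_i| >= h k) <= K 3^-k] for a suitable step [h], and by independence
    [E exp(a sum_i |X_i|)] is finite as soon as [a h <= 1], because [e < 3]. *)

(** * Geometric decay of the tails of laws in the class *)

Section tail_decay.
Context {R : realType}.
Implicit Types (mu : probability R R).

Lemma prob_fin_num mu (A : set R) : measurable A -> mu A \is a fin_num.
Proof. exact: fin_num_measure. Qed.

Lemma measurable_upper_tail mu :
  measurable_fun setT ((fun y => mu [set` `[y, +oo[]) : R -> \bar R).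
Proof.
rewrite (_ : (fun y => _) = EFin \o (fun y : R => fine (mu [set` `[y, +oo[]))).
  apply/measurable_EFinP; apply: (@nonincreasing_measurable R) => // y z yz.
  apply: fine_le; rewrite ?prob_fin_num//; apply: le_measure; rewrite ?inE//.
  by move=> u /=; rewrite !in_itv/= !andbT; exact: le_trans.
by apply/funext => y /=; rewrite fineK ?prob_fin_num.
Qed.

Lemma measurable_lower_tail mu :
  measurable_fun setT ((fun y => mu [set` `]-oo, y]]) : R -> \bar R).
Proof.
rewrite (_ : (fun y => _) = EFin \o (fun y : R => fine (mu [set` `]-oo, y]]))).
  apply/measurable_EFinP; apply: (@nondecreasing_measurable R) => // y z yz.
  apply: fine_le; rewrite ?prob_fin_num//; apply: le_measure; rewrite ?inE//.
  by move=> u /=; rewrite !in_itv/= => uy; exact: le_trans yz.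
by apply/funext => y /=; rewrite fineK ?prob_fin_num.
Qed.

(** Keep only the mass that [nu_plus] puts on the interval from [x] to [x + h]. There the power
    weight is smallest at the left end and the tail of [mu] is smallest at the right end, which
    bounds the density below by a constant. *)
Lemma nu_plus_ge (beta m x h : R) mu : 0 <= beta -> 0 < m -> m <= x -> 0 <= h ->
  ((h * x `^ beta)%:E * mu [set` `[(x + h)%R, +oo[] <=
   nu_plus beta m mu [set` `[x, +oo[])%E.
Proof.
move=> b0 m0 mx h0; rewrite /nu_plus.
have mf : measurable_fun setT
    ((fun y => ((y `^ beta)%R%:E * mu [set` `[y, +oo[])%E) : R -> \bar R).
  apply: emeasurable_funM; last exact: measurable_upper_tail.
  by apply/measurable_EFinP; exact: measurable_powR.
apply: (@le_trans _ _ (\int[lebesgue_measure]_(y in `[x, (x + h)%R])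
   ((x `^ beta)%:E * mu [set` `[(x + h)%R, +oo[]))%E).
  rewrite integral_cst//= lebesgue_measure_itv/= lte_fin ltrDl.
  case: ltgtP h0 => // [h0 _|<- _]; last by rewrite mul0r mul0e mule0.
  by rewrite EFinN -EFinD addrAC subrr add0r [leRHS]muleC muleA EFinM.
apply: (@le_trans _ _ (\int[lebesgue_measure]_(y in `[x, (x + h)%R])
   ((y `^ beta)%:E * mu [set` `[y, +oo[]))%E).
  apply: ge0_le_integral => //.
  - by move=> y _; rewrite mule_ge0// lee_fin powR_ge0.
  - exact: measurable_funTS.
  - move=> y /=; rewrite in_itv/= => /andP[xy yx].
    apply: lee_pmul => //; first by rewrite lee_fin powR_ge0.
      have x0 : 0 <= x by rewrite (le_trans _ mx)// ltW.
      by rewrite lee_fin ge0_ler_powR// nnegrE// (le_trans x0).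
    apply: le_measure; rewrite ?inE// => u /=.
    by rewrite !in_itv/= !andbT; exact: le_trans.
apply: ge0_subset_integral => //.
- exact: measurableI.
- exact: measurable_funTS.
- by move=> y _; rewrite mule_ge0// lee_fin powR_ge0.
- move=> y /=; rewrite !in_itv/= !andbT => /andP[xy _].
  by rewrite xy (le_trans mx).
Qed.

Lemma nu_minus_ge (beta m x h : R) mu :
  0 <= beta -> 0 < m -> m <= x -> 0 <= h ->
  ((h * x `^ beta)%:E * mu [set` `]-oo, (- (x + h))%R]] <=
   nu_minus beta m mu [set` `]-oo, (- x)%R]])%E.
Proof.
move=> b0 m0 mx h0; rewrite /nu_minus.
have mf : measurable_fun setT
    ((fun y => ((`|y| `^ beta)%R%:E * mu [set` `]-oo, y]])%E) : R -> \bar R).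
  apply: emeasurable_funM; last exact: measurable_lower_tail.
  apply/measurable_EFinP; apply: (measurableT_comp (measurable_powR beta)).
  exact: normr_measurable.
apply: (@le_trans _ _ (\int[lebesgue_measure]_(y in `[(- (x + h))%R, (- x)%R])
   ((x `^ beta)%:E * mu [set` `]-oo, (- (x + h))%R]]))%E).
  rewrite integral_cst//= lebesgue_measure_itv/= lte_fin ltrN2 ltrDl.
  case: ltgtP h0 => // [h0 _|<- _]; last by rewrite mul0r mul0e mule0.
  rewrite EFinN -EFinD [leRHS]muleC muleA -EFinM.
  by rewrite (_ : (- x - - (x + h)) = h)%R //; ring.
apply: (@le_trans _ _ (\int[lebesgue_measure]_(y in `[(- (x + h))%R, (- x)%R])
   ((`|y| `^ beta)%:E * mu [set` `]-oo, y]]))%E).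
  apply: ge0_le_integral => //.
  - by move=> y _; rewrite mule_ge0// lee_fin powR_ge0.
  - exact: measurable_funTS.
  - move=> y /=; rewrite in_itv/= => /andP[xy yx].
    apply: lee_pmul => //; first by rewrite lee_fin powR_ge0.
      have x0 : 0 <= x by rewrite (le_trans _ mx)// ltW.
      rewrite lee_fin ge0_ler_powR// ?nnegrE//.
      by rewrite lerNr in yx; rewrite (le_trans yx)// -normrN ler_norm.
    apply: le_measure; rewrite ?inE// => u /=.
    by rewrite !in_itv/= => uy; exact: le_trans xy.
apply: ge0_subset_integral => //.
- exact: measurableI.
- exact: measurable_funTS.
- by move=> y _; rewrite mule_ge0// lee_fin powR_ge0.
- move=> y /=; rewrite !in_itv/= => /andP[_ xy].
  by rewrite xy (le_trans xy)// lerN2.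
Qed.

(** The class bounds [nu_plus] and [nu_minus] above by [s] times the tail at [x], while [nu_plus_ge]
    and [nu_minus_ge] bound them below by the tail one step [h] further out. The ratio of the two
    factors is at most 1/3, a rate chosen to beat 1/e. *)
Lemma tail_class_decay (beta m s x h : R) mu :
  0 <= beta -> 0 < m -> m <= x -> 0 < h -> 3 * s <= h * x `^ beta ->
  tail_class beta m s mu ->
  fine (mu [set` `[(x + h)%R, +oo[]) <= 3^-1 * fine (mu [set` `[x, +oo[]) /\
  fine (mu [set` `]-oo, (- (x + h))%R]]) <=
    3^-1 * fine (mu [set` `]-oo, (- x)%R]]).
Proof.
move=> b0 m0 mx h0 sh [tp tm].
have hx0 : 0 < h * x `^ beta.
  by rewrite mulr_gt0// powR_gt0// (lt_le_trans m0).
have key (u v : \bar R) : (u \is a fin_num -> v \is a fin_num -> 0 <= v ->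
    (h * x `^ beta)%:E * u <= s%:E * v -> (fine u <= 3^-1 * fine v)%R)%E.
  case: u => // u; case: v => // v _ _.
  rewrite -!EFinM !lee_fin /= => v0 H.
  rewrite -(ler_pM2l hx0) (le_trans H)// mulrA ler_wpM2r//.
  by rewrite ler_pdivlMr// mulrC.
split; apply: key; rewrite ?prob_fin_num//.
- apply: le_trans (tp _ mx).
  by apply: nu_plus_ge => //; exact: ltW.
- rewrite -lerN2 in mx.
  apply: le_trans (tm _ mx).
  by apply: nu_minus_ge => //; [rewrite -lerN2|exact: ltW].
Qed.

(** The decay step can be iterated from [h *+ k0] on, because its requirement on [x] persists as [x]
    grows. The factor 2 counts the two tails, and [3 ^+ k0] makes the bound trivial for
    [k <= k0]. *)
Lemma tail_class_geometric (beta m s h : R) (k0 : nat) :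
  0 <= beta -> 0 < m -> 0 < h -> m <= h *+ k0 ->
  3 * s <= h * (h *+ k0) `^ beta ->
  forall mu, tail_class beta m s mu ->
  forall k, fine (mu [set x | h *+ k <= `|x|]) <= 2 * 3 ^+ k0 * 3 ^- k.
Proof.
move=> b0 m0 h0 mk0 sk0 mu tmu k.
have hk0 j : 0 <= h *+ j by rewrite mulrn_wge0 ?ltW.
have mA : measurable [set x : R | h *+ k <= `|x|].
  have -> : [set x : R | h *+ k <= `|x|] = Num.norm @^-1` `[h *+ k, +oo[.
    by apply/seteqP; split => x /=; rewrite in_itv/= andbT.
  by rewrite -[_ @^-1` _]setTI; exact: normr_measurable.
have [kk0|k0k] := leqP k k0.
  apply: (@le_trans _ _ 1); first by rewrite -lee_fin fineK ?prob_fin_num// probability_le1.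
  rewrite -(subnK kk0) exprD mulrA mulfK ?expf_neq0//.
  by rewrite -[leLHS]mulr1 ler_pM ?exprn_ege1 ?ler1n.
have dec j : fine (mu [set` `[h *+ (k0 + j), +oo[]) <= 3 ^- j /\
    fine (mu [set` `]-oo, - (h *+ (k0 + j))]]) <= 3 ^- j.
  elim: j => [|j [IH1 IH2]].
    by rewrite addn0 expr0 invr1; split;
      rewrite -lee_fin fineK ?prob_fin_num// probability_le1.
  have hj : h *+ k0 <= h *+ (k0 + j) by rewrite mulrnDr lerDl.
  have [] := @tail_class_decay beta m s (h *+ (k0 + j)) h mu b0 m0
     (le_trans mk0 hj) h0 _ tmu.
    apply: (le_trans sk0); rewrite ler_pM2l//.
    by rewrite ge0_ler_powR// nnegrE.
  rewrite -mulrSr -addnS exprS invfM => H1 H2; split.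
    by rewrite (le_trans H1)// ler_pM2l.
  by rewrite (le_trans H2)// ler_pM2l.
have [H1 H2] := dec (k - k0)%N.
rewrite subnKC in H1 H2; last exact: ltnW.
have -> : 2 * 3 ^+ k0 * 3 ^- k = 3 ^- (k - k0) + 3 ^- (k - k0) :> R.
  rewrite -mulr2n -[in 3 ^- k](subnKC (ltnW k0k)) exprD invfM mulrA -(mulrA 2).
  by rewrite divff ?expf_neq0// mulr1 mulr_natl.
apply: le_trans (lerD H1 H2).
rewrite -lee_fin EFinD !fineK ?prob_fin_num//.
apply: le_trans (measureU2 _ _ _) => //.
apply: le_measure; rewrite ?inE//; first exact: measurableU.
move=> x /=; rewrite !in_itv/= andbT ler_normr => /orP[]; first by left.
by rewrite lerNr; right.
Qed.

(* For [beta = 0] the step is [h = m + 3 sigma] and the threshold is exactly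
   the range of slopes allowed by the modified log-Sobolev inequality. *)
Lemma tail_class_geometric_step (beta m sigma a : R) :
  0 <= beta -> 0 < m -> 0 <= sigma -> 0 <= a ->
  (beta = 0 -> a * (m + 3 * sigma) <= 1) ->
  exists h K : R, [/\ 0 < h, a * h <= 1, 0 <= K &
    forall mu, tail_class beta m (sigma `^ (beta + 1)) mu ->
    forall k, fine (mu [set x | h *+ k <= `|x|]) <= K * 3 ^- k].
Proof.
move=> b0 m0 s0 a0 ab.
suff [h [k0 [h0 ah mk0 sk0]]] : exists (h : R) (k0 : nat),
    [/\ 0 < h, a * h <= 1, m <= h *+ k0 &
        3 * sigma `^ (beta + 1) <= h * (h *+ k0) `^ beta].
  exists h, (2 * 3 ^+ k0); split => //.
  exact: tail_class_geometric mk0 sk0.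
case: ltgtP b0 => // [b0 _|b0 _]; last first.
  exists (m + 3 * sigma), 1%N; split => //.
  - by rewrite ltr_wpDr// mulr_ge0.
  - by rewrite ab.
  - by rewrite mulr1n lerDl mulr_ge0.
  - rewrite -b0 powRr0 add0r powRr1// mulr1 lerDr; exact: ltW.
(* For positive [beta] the step may be as short as [a] demands: the growth of the power weight
   compensates, once [k0] is so large that [h *+ k0] exceeds the threshold [y]. *)
pose h := (a + 1)^-1.
have a1 : 0 < a + 1 by rewrite ltr_wpDl.
have h0 : 0 < h by rewrite invr_gt0.
pose y := Num.max m ((3 * sigma `^ (beta + 1) / h) `^ beta^-1).
have [k0 yk0] : exists k0 : nat, y <= h *+ k0.
  exists (Num.truncn (y / h)).+1.
  rewrite -mulr_natr -ler_pdivrMl// mulrC ltW//.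
  exact: truncnS_gt.
exists h, k0; split => //.
- by rewrite ler_pdivrMr// mul1r lerDl.
- by rewrite (le_trans _ yk0)// le_max lexx.
- rewrite -ler_pdivrMl// mulrC.
  have H : 0 <= 3 * sigma `^ (beta + 1) / h.
    apply: divr_ge0; last exact: ltW.
    by apply: mulr_ge0; rewrite ?powR_ge0.
  rewrite -[leLHS]powRr1//; set z := (X in X `^ _ <= _).
  rewrite -[X in z `^ X](@mulVf _ beta) ?gt_eqF// powRrM.
  rewrite ge0_ler_powR ?(ltW b0) ?nnegrE ?powR_ge0 ?mulrn_wge0 ?(ltW h0)//.
  by rewrite (le_trans _ yk0)// le_max lexx orbT.
Qed.

End tail_decay.

(** * Exponential moments under independence *)

Section product_moment.
Context {d : measure_display} {T : measurableType d} {R : realType}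
  (P : probability T R) (n : nat) (X : 'I_n -> {RV P >-> R}).
Hypothesis indX : mutually_independent X.

(** Expanding the product of sums gives one term for each choice [f] of an index per coordinate, and
    that term is a constant times the indicator of an intersection of events, to which independence
    applies directly. The same expansion, read backwards on the probabilities, yields the right-hand
    side. *)
Lemma independent_integral_prod_simple (N : nat) (c : 'I_N -> R)
    (A : 'I_N -> set R) :
  (forall k, 0 <= c k) -> (forall k, measurable (A k)) ->
  (\int[P]_w (\prod_i \sum_k c k * \1_(A k) (X i w))%:E =
   (\prod_i \sum_k c k * fine (P (X i @^-1` A k)))%:E)%E.
Proof.
move=> c0 mA.
pose B (f : {ffun 'I_n -> 'I_N}) := \bigcap_(i in [set: 'I_n]) (X i @^-1` A (f i)).
have mB f : measurable (B f).
  apply: fin_bigcap_measurable => // i _.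
  exact: (measurable_funPTI (X i)).
have prodE w : \prod_i \sum_k c k * \1_(A k) (X i w) =
    \sum_(f : {ffun 'I_n -> 'I_N}) (\prod_i c (f i)) * \1_(B f) w.
  rewrite bigA_distr_bigA/=; apply: eq_bigr => f _; rewrite big_split/=.
  congr (_ * _); rewrite indicE; have [Bw|nBw] := pselect (B f w).
    by rewrite mem_set// big1// => i _; rewrite indicE mem_set//; exact: Bw.
  rewrite memNset//.
  have [i nAi] : exists i, ~ A (f i) (X i w).
    by apply/existsNP => H; apply: nBw => i _; exact: H.
  by rewrite (bigD1 i)//= indicE memNset// mul0r.
under eq_integral do rewrite prodE -sumEFin.
rewrite ge0_integral_sum//; last 2 first.
- move=> f; apply/measurable_EFinP; apply: measurable_funM => //.
- by move=> f w _; rewrite lee_fin mulr_ge0// prodr_ge0.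
rewrite bigA_distr_bigA/= -sumEFin; apply: eq_bigr => f _.
under eq_integral do rewrite EFinM.
rewrite ge0_integralZl_EFin//; last 2 first.
- exact/measurable_EFinP.
- exact: prodr_ge0.
rewrite integral_indic// setIT big_split/= EFinM; congr (_ * _)%E.
have := indX (finset.setTfor 'I_n) (fun i => mA (f i)).
rewrite (_ : \bigcap_(i in _) _ = B f); last first.
  by congr (\bigcap_(i in _) _); apply/seteqP; split => // i _ /=; rewrite inE.
by move=> ->; congr EFin; apply: eq_bigl => i; rewrite inE.
Qed.

Let S w := \sum_i `|X i w|.

Lemma measurable_expR_sum_norm a : measurable_fun setT (fun w => expR (a * S w)).
Proof.
apply: measurableT_comp => //; apply: measurable_funM => //.
apply: measurable_sum => i; exact: measurableT_comp.
Qed.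

(** From exp(-1/8) >= 7/8 follows e <= (8/7)^8, which is below 3. *)
Lemma expR1_lt3 : expR 1 < 3 :> R.
Proof.
have e8 : expR (8^-1) <= 8 / 7 :> R.
  have := expR_ge1Dx (- 8^-1 : R); rewrite expRN.
  have e0 : 0 < expR (8^-1) :> R by exact: expR_gt0.
  by rewrite -[leRHS]mul1r ler_pdivlMr// => H; lra.
have -> : expR 1 = expR (8^-1) ^+ 8 :> R.
  by rewrite -expRM_natl; congr expR; lra.
apply: (@le_lt_trans _ _ ((8 / 7) ^+ 8)); last by lra.
by rewrite lerXn2r// ?nnegrE ?expR_ge0//; lra.
Qed.

(* The exponential is dominated by a step function taking the value
   [e^(k+1)] on [{h k <= |x|}]. *)
Lemma expR_sum_norm_lty (h K a : R) : 0 < h -> 0 <= a -> a * h <= 1 -> 0 <= K ->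
  (forall i k, fine (P [set w | h *+ k <= `|X i w|]) <= K * 3 ^- k) ->
  (\int[P]_w (expR (a * S w))%:E < +oo)%E.
Proof.
move=> h0 a0 ah K0 tl.
pose A k := [set x : R | h *+ k <= `|x|].
have mA k : measurable (A k).
  have -> : A k = Num.norm @^-1` `[h *+ k, +oo[.
    by apply/seteqP; split => x /=; rewrite in_itv/= andbT.
  by rewrite -[_ @^-1` _]setTI; exact: normr_measurable.
(* In each coordinate the step function has expectation at most the sum of [e * K * r ^ k], a
   geometric series bounded by [M]. *)
pose r : R := expR 1 / 3.
have r0 : 0 <= r by rewrite divr_ge0// expR_ge0.
have r1 : r < 1 by rewrite ltr_pdivrMr// mul1r expR1_lt3.
pose M := expR 1 * K / (1 - r).
have M0 : 0 <= M by rewrite divr_ge0 ?subr_ge0 ?(ltW r1)// mulr_ge0// expR_ge0.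
pose F N w : R := \prod_i \sum_(k < N) expR (k.+1)%:R * \1_(A k) (X i w).
have bnd N : (\int[P]_w (F N w)%:E <= (M ^+ n)%:E)%E.
  rewrite independent_integral_prod_simple//.
  rewrite lee_fin -[in M ^+ n](card_ord n) -prodr_const.
  apply: ler_prod => i _; apply/andP; split.
    by apply: sumr_ge0 => k _; rewrite mulr_ge0 ?expR_ge0// fine_ge0.
  apply: (@le_trans _ _ (\sum_(k < N) expR 1 * K * r ^+ k)).
    apply: ler_sum => k _.
    apply: (@le_trans _ _ (expR k.+1%:R * (K * 3 ^- k))).
      by rewrite ler_wpM2l ?expR_ge0// tl.
    by rewrite -[k.+1%:R]mulr1 expRM_natl exprS /r expr_div_n mulrACA.
  rewrite -mulr_sumr ler_wpM2l ?mulr_ge0 ?expR_ge0//.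
  rewrite -[leRHS]mul1r ler_pdivlMr ?subr_gt0//.
  have -> : (\sum_(k < N) r ^+ k) * (1 - r) = 1 - r ^+ N.
    by rewrite -opprB mulrN mulrC -subrX1 opprB.
  by rewrite gerBl exprn_ge0.
(* The truncated step function [F N] dominates the exponential only where all coordinates are below
   [h *+ N]. These events increase to the whole space, and the bound [M ^+ n] does not depend on
   [N], so monotone convergence concludes. *)
pose B N := [set w | forall i, `|X i w| < h *+ N].
have mB N : measurable (B N).
  have -> : B N = \bigcap_(i in [set: 'I_n]) (X i @^-1` (~` A N)).
    apply/seteqP; split => w /= Bw i; first by move=> _ /=; apply/negP; rewrite -ltNge.
    by rewrite ltNge; apply/negP; exact: Bw.
  apply: fin_bigcap_measurable => // i _.
  by apply: (measurable_funPTI (X i)); exact: measurableC.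
have mS := measurable_expR_sum_norm a.
have UB : \bigcup_N B N = setT.
  apply/seteqP; split => // w _.
  exists (Num.truncn (S w / h)).+1 => //= i.
  apply: (@le_lt_trans _ _ (S w)); first by rewrite /S (bigD1 i)//= lerDl sumr_ge0.
  by rewrite -mulr_natr -ltr_pdivrMl// mulrC truncnS_gt.
have le_step N : (\int[P]_(w in B N) (expR (a * S w))%:E <= (M ^+ n)%:E)%E.
  apply: le_trans (bnd N).
  have mF : measurable_fun setT (F N).
    apply: measurable_prod => i _; apply: measurable_sum => k.
    by apply: measurable_funM => //; apply: measurableT_comp.
  have F0 w : 0 <= F N w.
    by apply: prodr_ge0 => i _; apply: sumr_ge0 => k _; rewrite mulr_ge0 ?expR_ge0.
  apply: (@le_trans _ _ (\int[P]_(w in B N) (F N w)%:E)%E); last first.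
    apply: ge0_subset_integral => //; first exact/measurable_EFinP.
    by move=> w _; rewrite lee_fin F0.
  apply: ge0_le_integral => //.
  - by apply/measurable_EFinP; exact: measurable_funTS.
  - by apply/measurable_EFinP; exact: measurable_funTS.
  (* One term of each sum suffices: with [k] the integer part of |X_i| / h, one has a |X_i| <= a h
     (k + 1) <= k + 1, and [B N] ensures [k < N]. *)
  move=> w Bw; rewrite lee_fin mulr_sumr expR_sum.
  apply: ler_prod => i _; rewrite expR_ge0/=.
  have x0 : 0 <= `|X i w| / h by rewrite divr_ge0// ltW.
  have /andP[] := truncn_itv x0; set k := Num.truncn _ => kx xk.
  have kN : (k < N)%N.
    rewrite -(ltr_nat R) (le_lt_trans kx)// ltr_pdivrMr// mulr_natl; exact: Bw.
  rewrite (bigD1 (Ordinal kN))//= -[leLHS]addr0 lerD//; last first.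
    by apply: sumr_ge0 => j _; rewrite mulr_ge0 ?expR_ge0.
  rewrite indicE mem_set/=; last first.
    by rewrite /A/= -mulr_natl -ler_pdivlMr.
  rewrite mulr1 ler_expR (@le_trans _ _ (a * (k.+1%:R * h)))//.
    by rewrite ler_wpM2l// -ler_pdivrMr// ltW.
  by rewrite mulrCA -[leRHS]mulr1 ler_wpM2l.
have := @ge0_nondecreasing_set_cvg_integral _ _ _ B
  (fun w => (expR (a * S w))%:E) P.
rewrite UB => H.
apply: (@le_lt_trans _ _ (M ^+ n)%:E); last by rewrite ltry.
have {}H : (\int[P]_(w in B i) (expR (a * S w))%:E)%E @[i --> \oo] -->
  (\int[P]_w (expR (a * S w))%:E)%E.
  apply: H => //.
  - move=> i j ij; apply/subsetPset => w Bw k; rewrite (lt_le_trans (Bw k))//.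
    by rewrite ler_pMn2l.
  - by move=> i; apply/measurable_EFinP; exact: measurable_funTS.
rewrite -(cvg_lim _ H)//; apply: lime_le; first by apply/cvg_ex; eexists; exact: H.
by apply: nearW => N; exact: le_step.
Qed.

End product_moment.

(** * Measurability of continuous functions of a random vector *)

Section measurable_rvec.
Context {d : measure_display} {T : measurableType d} {R : realType}
  (P : probability T R) (n : nat) (X : 'I_n -> {RV P >-> R}).

(* A continuous function of a random vector is the limit of its values at the
   vectors with coordinates rounded down to multiples of [1/(k+1)], and each
   of these takes countably many values. *)
Lemma measurable_continuous_rvec (f : 'rV[R]_n -> R) :
  continuous f -> measurable_fun setT (fun w => f (rvec X w)).
Proof.
move=> cf.
pose rd (k : nat) (x : R) : R := (Num.floor (x * k.+1%:R))%:~R / k.+1%:R.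
pose xi k w : 'rV[R]_n := \row_i rd k (X i w).
apply: (@measurable_fun_cvg _ _ _ _ (fun k w => f (xi k w))) => [k|w _].
  move=> _ Y mY; rewrite setTI.
  pose V (z : {ffun 'I_n -> int}) : 'rV[R]_n := \row_i ((z i)%:~R / k.+1%:R).
  pose E (z : {ffun 'I_n -> int}) := \bigcap_(i in [set: 'I_n])
    (X i @^-1` [set x | Num.floor (x * k.+1%:R) = z i]).
  have -> : (fun w => f (xi k w)) @^-1` Y =
      \bigcup_z (if pselect (Y (f (V z))) then E z else set0).
    apply/seteqP; split => w /=.
      move=> Yw; exists [ffun i => Num.floor (X i w * k.+1%:R)] => //=.
      have -> : V [ffun i => Num.floor (X i w * k.+1%:R)] = xi k w.
        by apply/rowP => i; rewrite !mxE ffunE.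
      by case: pselect => // _ i _ /=; rewrite ffunE.
    move=> [z _]; case: pselect => // Yz Ez.
    suff -> : xi k w = V z by [].
    by apply/rowP => i; rewrite !mxE /rd (Ez i).
  apply: countable_bigcupT_measurable => [|z]; first exact: countableP.
  case: pselect => //= _; apply: fin_bigcap_measurable => // i _.
  apply: (measurable_funPTI (X i)).
  have -> : [set x : R | Num.floor (x * k.+1%:R) = z i] =
      `[(z i)%:~R / k.+1%:R, (z i + 1)%:~R / k.+1%:R[%classic.
    apply/seteqP; split => x /=; rewrite in_itv/= ler_pdivrMr// ltr_pdivlMr//.
      by move=> <-; exact: floor_itv.
    exact: floor_def.
  exact: measurable_itv.
apply: (cvg_comp _ f); last exact: (cf (rvec X w)).
apply/cvg_ballP => e e0; near=> k.
have ek : e^-1 < k.+1%:R.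
  near: k; exists (Num.truncn e^-1) => //= k /= ek.
  by rewrite (lt_le_trans (truncnS_gt _))// ler_nat ltnS.
rewrite -ball_normE /= [X in X < _]mx_normrE.
apply: bigmax_lt => // -[j i] _ /=; rewrite !mxE /rd.
have k0 : 0 < k.+1%:R :> R by [].
have /andP[h1 h2] := floor_itv (X i w * k.+1%:R).
rewrite intrD in h2.
set z := (Num.floor _)%:~R in h1 h2 *.
rewrite ger0_norm ?subr_ge0 ?ler_pdivrMr//.
rewrite -(ltr_pM2r k0) mulrBl divfK ?gt_eqF//.
apply: (@lt_trans _ _ 1); first by rewrite ltrBlDl.
by rewrite -ltr_pdivrMl// mulr1.
Unshelve. all: by end_near. Qed.

End measurable_rvec.

(** * Scaling, gradient bounds and suprema for smooth functions *)

Section calculus.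
Context {R : realType} {n : nat}.
Implicit Types (f : 'rV[R]_n -> R) (x v : 'rV[R]_n).

Lemma partialZ (c : R) f (i : 'I_n) :
  (forall x, derivable f x (delta_mx ord0 i)) ->
  partial i (c \*: f) = c \*: partial i f.
Proof. by move=> df; apply/funext => x; rewrite /partial deriveZ. Qed.

Lemma iter_partialZ (c : R) f (s : seq 'I_n) :
  smooth f -> iter_partial s (c \*: f) = c \*: iter_partial s f.
Proof.
move=> sf; elim: s => //= i s ->.
by rewrite partialZ// => x; exact: (sf s).1.
Qed.

(** Herbst's argument uses the log-Sobolev inequality for all positive multiples of one function, so
    smoothness, gradient and convexity are followed under scaling. *)
Lemma smoothZ (c : R) f : smooth f -> smooth (c \*: f).
Proof.
move=> sf s; rewrite iter_partialZ//; split.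
  by move=> i x; apply: derivableZ; exact: (sf s).1.
move=> x; exact: (cvgZl_tmp (k := c) ((sf s).2 x)).
Qed.

Lemma gradZ (c : R) f x : smooth f -> grad (c \*: f) x = c *: grad f x.
Proof.
move=> sf; apply/rowP => i; rewrite !mxE partialZ// => y.
exact: (sf [::]).1.
Qed.

Lemma convex_functionZ (c : R) f : 0 <= c ->
  convex_function setT f -> convex_function setT (c \*: f).
Proof.
move=> c0 cf t x y xT yT; have := cf t x y xT yT.
rewrite !convRE => /(ler_wpM2l c0); rewrite mulrDr !(mulrCA c) => H.
exact: H.
Qed.

Lemma smooth_continuous f : smooth f -> continuous f.
Proof. by move=> /(_ [::])[]. Qed.

Lemma smooth_partial_continuous f (i : 'I_n) : smooth f -> continuous (partial i f).
Proof. by move=> /(_ [:: i])[]. Qed.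

(** A coordinate vector has sup norm at most 1, so the Lipschitz constant bounds the difference
    quotients along it, hence their limit. *)
Lemma lipschitz_partial_le f : smooth f -> lipschitz f ->
  exists L : R, 0 <= L /\ forall (i : 'I_n) x, `|partial i f x| <= L.
Proof.
move=> sf /pinfty_ex_gt0[L L0 lipf]; exists L; split; first exact: ltW.
move=> i x; have df := (sf [::]).1 i x.
have e1 : `|delta_mx ord0 i : 'rV[R]_n| <= 1.
  rewrite [X in X <= _]mx_normrE; apply: bigmax_le => // -[j k] _ /=.
  by rewrite mxE; case: (_ && _); rewrite ?normr1 ?normr0.
have cn : `|h^-1 *: ((f \o shift x) (h *: delta_mx ord0 i) - f x)|
    @[h --> 0^'] --> `|partial i f x|.
  by apply: cvg_norm; exact: df.
rewrite -(cvg_lim _ cn)//; apply: limr_le; first by apply/cvg_ex; eexists; exact: cn.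
near=> h.
have h0 : h != 0 by near: h; exact: nbhs_dnbhs_neq.
rewrite normrZ normfV ler_pdivrMl ?normr_gt0//.
have := lipf (h *: delta_mx ord0 i + x, x) (conj Logic.I Logic.I).
rewrite /= addrK normrZ => /le_trans; apply.
by rewrite [leRHS]mulrC ler_wpM2l ?(ltW L0)// ler_piMr.
Unshelve. all: by end_near. Qed.

(** Mean value theorem for the restriction of [f] to a line parallel to a coordinate axis. *)
Lemma partial_le_norm_sub f (B : R) :
  (forall (i : 'I_n) x, derivable f x (delta_mx ord0 i)) ->
  (forall (i : 'I_n) x, `|partial i f x| <= B) ->
  forall (i : 'I_n) (r : R) x, `|f (x + r *: delta_mx ord0 i) - f x| <= B * `|r|.
Proof.
move=> df Bf i r x.
pose g s := f (x + s *: delta_mx ord0 i).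
have dg (s : R) : is_derive s 1 g (partial i f (x + s *: delta_mx ord0 i)).
  have := df i (x + s *: delta_mx ord0 i).
  have E : (fun h : R => h^-1 *: ((g \o shift s) h%:A - g s)) =
    (fun h : R => h^-1 *: ((f \o shift (x + s *: delta_mx ord0 i)) (h *: delta_mx ord0 i)
        - f (x + s *: delta_mx ord0 i))).
    apply/funext => h; rewrite /g /= [h%:A]mulr1; congr (_ *: (f _ - _)).
    by rewrite scalerDl addrCA.
  by split; rewrite /derivable /partial /derive E.
have cg : continuous g.
  by move=> s; apply: differentiable_continuous; apply/derivable1_diffP; case: (dg s).
have H a b : a <= b -> `|g b - g a| <= B * (b - a).
  move=> ab; have [c _ ->] := @MVT_segment R g _ a b ab (fun s _ => dg s)
     (continuous_subspaceT cg).
  by rewrite normrM ler_pM// ger0_norm// subr_ge0.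
have g0 : g 0 = f x by rewrite /g scale0r addr0.
rewrite -/(g r) -g0; have [r0|r0] := leP 0 r.
  by have := H _ _ r0; rewrite subr0 (ger0_norm r0).
by have := H _ _ (ltW r0); rewrite distrC sub0r (ltr0_norm r0).
Qed.

(** Go from 0 to [x] changing one coordinate at a time. The sup norm of the gradient is thus paired
    with the l_1 norm of [x], whose exponential moments factor over independent coordinates. *)
Lemma partial_le_norm_sub_sum f (B : R) :
  (forall (i : 'I_n) x, derivable f x (delta_mx ord0 i)) ->
  (forall (i : 'I_n) x, `|partial i f x| <= B) ->
  forall x, `|f x - f 0| <= B * \sum_i `|x ord0 i|.
Proof.
move=> df Bf x.
suff H (s : seq 'I_n) : `|f (\sum_(i <- s) x ord0 i *: delta_mx ord0 i) - f 0| <=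
    B * \sum_(i <- s) `|x ord0 i|.
  by rewrite {1}(row_sum_delta x); exact: H.
elim: s => [|i s IH]; first by rewrite !big_nil subrr normr0 mulr0.
rewrite !big_cons; set y := \sum_(j <- s) _ *: _ in IH *.
rewrite (le_trans (ler_distD (f y) _ _))// (addrC _ y) mulrDr lerD//.
exact: partial_le_norm_sub.
Qed.

Lemma lpnorm_ge0 (p : R) v : 0 <= lpnorm p v.
Proof. exact: powR_ge0. Qed.

Lemma lpnormZ (p c : R) v : p != 0 -> 0 <= c -> lpnorm p (c *: v) = c * lpnorm p v.
Proof.
move=> p0 c0; rewrite /lpnorm.
under eq_bigr do rewrite mxE normrM (ger0_norm c0) powRM//.
rewrite -mulr_sumr powRM ?powR_ge0//; last by apply: sumr_ge0 => i _; exact: powR_ge0.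
by rewrite -powRrM mulfV// powRr1.
Qed.

Lemma lpnorm_le (p L : R) v : 0 < p -> (forall i, `|v ord0 i| <= L) ->
  lpnorm p v <= (n%:R * L `^ p) `^ p^-1.
Proof.
move=> p0 vL; rewrite ge0_ler_powR ?nnegrE ?invr_ge0 ?(ltW p0)//.
- by apply: sumr_ge0 => i _; exact: powR_ge0.
- by rewrite mulr_ge0 ?powR_ge0.
rewrite (@le_trans _ _ (\sum_(i < n) L `^ p))//.
  apply: ler_sum => i _; rewrite ge0_ler_powR ?nnegrE ?(ltW p0)//.
  exact: le_trans (vL i).
by rewrite sumr_const card_ord mulr_natl.
Qed.

Lemma measurable_lpnorm_grad (d : measure_display) (T : measurableType d)
  (P : probability T R) (X : 'I_n -> {RV P >-> R}) (p : R) f : smooth f ->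
  measurable_fun setT (fun w => lpnorm p (grad f (rvec X w))).
Proof.
move=> sf; apply: (measurableT_comp (measurable_powR _)).
apply: measurable_sum => i; apply: (measurableT_comp (measurable_powR _)).
apply: measurableT_comp => //.
under eq_fun do rewrite mxE.
by apply: measurable_continuous_rvec; exact: smooth_partial_continuous.
Qed.

Lemma supE_fin_num (g : 'rV[R]_n -> R) (M : R) : (forall x, 0 <= g x <= M) ->
  exists s : R, [/\ supE g = s%:E, 0 <= s & forall x, g x <= s].
Proof.
move=> gM.
have ub x : ((g x)%:E <= supE g)%E by apply: ereal_sup_ubound; exists x.
have le : (supE g <= M%:E)%E.
  by apply: ub_ereal_sup => _ [x _ <-]; rewrite lee_fin; case/andP: (gM x).
have ge0 : (0 <= supE g)%E.
  by apply: le_trans (ub 0); rewrite lee_fin; case/andP: (gM 0).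
exists (fine (supE g)).
have fin : supE g \is a fin_num by rewrite ge0_fin_numE// (le_lt_trans le)// ltry.
by split => [||x]; rewrite ?fineK ?fine_ge0// -lee_fin fineK.
Qed.

End calculus.

(** * Herbst's argument for a single random variable *)

Section herbst.
Context {d : measure_display} {T : measurableType d} {R : realType}
  (P : probability T R) (Z : {RV P >-> R}) (l0 : R).
Hypothesis l0_gt0 : 0 < l0.
Hypothesis intE : P.-integrable setT (fun w => (expR (2 * l0 * `|Z w|))%:E).

Let F (l : R) : R := \int[P]_w expR (l * Z w).
(** The derivative of the moment generating function [F], as [is_derive_F] shows. *)
Let F1 (l : R) : R := \int[P]_w (Z w * expR (l * Z w)).

Let measurable_expRZ l : measurable_fun setT (fun w => expR (l * Z w)).
Proof. by apply: measurableT_comp => //; exact: measurable_funM. Qed.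

(** The gap [l0 / 2] between the slopes [3 / 2 * l0] and [2 * l0] absorbs the factor |Z|, through y
    <= exp(y). The right-hand side serves as dominating function on an open interval of slopes that
    contains both 0 and [l0]. *)
Let norm_le_expR (l : R) w : `|l| <= 3 / 2 * l0 ->
  `|Z w| * expR (l * Z w) <= 2 / l0 * expR (2 * l0 * `|Z w|).
Proof.
move=> ll.
have -> : 2 * l0 * `|Z w| = l0 * `|Z w| / 2 + 3 / 2 * l0 * `|Z w| by field.
rewrite expRD mulrA; apply: ler_pM => //.
  have -> : `|Z w| = 2 / l0 * (l0 * `|Z w| / 2) by field; rewrite gt_eqF.
  rewrite ler_wpM2l//; first by rewrite divr_ge0// ltW.
  rewrite (_ : 2 / l0 * _ = `|Z w|); last by field; rewrite gt_eqF.
  by rewrite (le_trans _ (expR_ge1Dx _))// lerDr.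
rewrite ler_expR (le_trans (ler_norm _))// normrM ler_wpM2r//.
Qed.

Let integrable_expR l : `|l| <= 3 / 2 * l0 ->
  P.-integrable setT (EFin \o (fun w => expR (l * Z w))).
Proof.
move=> ll; apply: le_integrable intE => //; first exact/measurable_EFinP.
move=> w _; rewrite lee_fin !(ger0_norm (expR_ge0 _)) ler_expR.
rewrite (le_trans (ler_norm _))// normrM ler_wpM2r// (le_trans ll)//.
by rewrite ler_wpM2r ?ltW//; lra.
Qed.

Let integrable_ZexpR l : `|l| <= 3 / 2 * l0 ->
  P.-integrable setT (EFin \o (fun w => Z w * expR (l * Z w))).
Proof.
move=> ll; have := integrableZl measurableT (2 / l0) intE.
apply: le_integrable => //; first by apply/measurable_EFinP; exact: measurable_funM.
move=> w _; rewrite -EFinM lee_fin [leLHS]normrM (ger0_norm (expR_ge0 _)).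
by rewrite (le_trans (norm_le_expR _ ll))// ler_norm.
Qed.

(** A positive function has zero integral only if it vanishes almost everywhere, which here would
    make the whole space negligible. *)
Let F_gt0 l : `|l| <= 3 / 2 * l0 -> 0 < F l.
Proof.
move=> ll; rewrite lt_neqAle; apply/andP; split; last first.
  by apply: Rintegral_ge0 => w _; exact: expR_ge0.
apply/negP => /eqP F0.
have : (\int[P]_w (expR (l * Z w))%:E = 0)%E.
  have := integrable_fin_num measurableT (integrable_expR ll).
  by move=> /fineK <-; rewrite /F /Rintegral in F0; rewrite -F0.
have mE : measurable_fun setT (EFin \o (fun w => expR (l * Z w))).
  exact/measurable_EFinP.
have H := (ae_eq_integral_abs P measurableT mE).1.
move=> E0; have {}H : ae_eq P setT (EFin \o (fun w => expR (l * Z w))) (cst 0%E).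
  apply: H; rewrite -[RHS]E0; apply: eq_integral => w _ /=.
  by rewrite ger0_norm// expR_ge0.
have [A [mA A0 sA]] := H.
have AT : A = setT.
  apply/seteqP; split => // w _; apply: sA => /= /(_ Logic.I) [] e0.
  by have := expR_gt0 (l * Z w); rewrite e0 ltxx.
by move: (probability_setT P); rewrite -AT A0 => -[] /esym/eqP; rewrite oner_eq0.
Qed.

Let is_derive_F (l : R) : `|l| < 3 / 2 * l0 -> is_derive l 1 F (F1 l).
Proof.
move=> ll.
have I : `](- (3 / 2 * l0)), (3 / 2 * l0)[%classic l.
  by rewrite /= in_itv/= -ltr_norml.
have Ile (x : R) : `](- (3 / 2 * l0)), (3 / 2 * l0)[%classic x -> `|x| <= 3 / 2 * l0.
  by rewrite /= in_itv/= -ltr_norml => /ltW.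
pose f (x : R) w := expR (x * Z w).
have df (x : R) w : is_derive x 1 (f ^~ w) (Z w * expR (x * Z w)).
  rewrite [X in is_derive _ _ _ X](_ : _ = expR (x * Z w) * (Z w)); last by rewrite mulrC.
  apply: (@is_derive1_comp _ expR (fun x => x * Z w)).
  rewrite -[X in is_derive _ _ _ X]mulr1.
  rewrite (_ : (fun x => x * Z w) = (Z w) \*: id); last first.
    by apply/funext => y /=; rewrite mulrC.
  exact: is_deriveZ.
have p1 (x : R) w : partial1of2 f x w = Z w * expR (x * Z w).
  by rewrite partial1of2E; apply: derive_val.
have intf (x : R) : `](- (3 / 2 * l0)), (3 / 2 * l0)[%classic x ->
  P.-integrable setT (EFin \o f x) by move=> /Ile; exact: integrable_expR.
have derf (x : R) w : `](- (3 / 2 * l0)), (3 / 2 * l0)[%classic x -> setT w ->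
  derivable (f ^~ w) x 1 by move=> _ _; case: (df x w).
have G0 w : 0 <= 2 / l0 * expR (2 * l0 * `|Z w|).
  by rewrite mulr_ge0 ?expR_ge0// divr_ge0// ltW.
have intG : P.-integrable setT (EFin \o (fun w => 2 / l0 * expR (2 * l0 * `|Z w|))).
  exact: (integrableZl measurableT (2 / l0) intE).
have Gub (x : R) w : `](- (3 / 2 * l0)), (3 / 2 * l0)[%classic x -> setT w ->
    `|partial1of2 f x w| <= 2 / l0 * expR (2 * l0 * `|Z w|).
  move=> /Ile xl _; rewrite p1 normrM (ger0_norm (expR_ge0 _)).
  exact: norm_le_expR.
split; first exact: (derivable_under_integral measurableT I intf derf G0 intG Gub).
rewrite -derive1E.
rewrite (differentiation_under_integral measurableT I intf derf G0 intG Gub).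
by apply: eq_Rintegral => w _; rewrite p1.
Qed.

Let E_EFin (f : T -> R) : P.-integrable setT (EFin \o f) ->
  'E_P[f]%E = (\int[P]_w f w)%:E.
Proof.
move=> intf; rewrite unlock /Rintegral fineK//.
exact: (integrable_fin_num measurableT intf).
Qed.

(** The logarithm of the integrand is [l * Z], so the first term is l F'(l). It is finite, which
    selects the first branch of [Ent]. *)
Lemma Ent_expR (l : R) : `|l| <= 3 / 2 * l0 ->
  Ent P (fun w => expR (l * Z w)) = (l * F1 l - F l * ln (F l))%:E.
Proof.
move=> ll; rewrite /Ent.
have -> : (fun w => expR (l * Z w) * ln (expR (l * Z w))) =
    (fun w => l * (Z w * expR (l * Z w))).
  by apply/funext => w; rewrite expRK mulrC mulrA.
rewrite E_EFin; last exact: (integrableZl measurableT l (integrable_ZexpR ll)).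
rewrite ltry E_EFin; last exact: integrable_expR.
rewrite lne_EFin; last exact: F_gt0.
rewrite -EFinM -EFinB; congr (_ - _)%:E.
by rewrite RintegralZl//; exact: integrable_ZexpR.
Qed.

(* Herbst's argument: the entropy bound says that [ln F(l) / l - A l] is
   nonincreasing, and its limit at [0+] is the mean. *)
Lemma herbst_mgf (A : R) :
  (forall l, 0 < l -> l <= l0 ->
    (Ent P (fun w => expR (l * Z w)) <=
     (A * l ^+ 2)%:E * 'E_P[fun w => expR (l * Z w)])%E) ->
  ('E_P[fun w => expR (l0 * Z w)] <=
    (expR (l0 * fine 'E_P[Z]%E + A * l0 ^+ 2))%:E)%E.
Proof.
move=> entA.
have small l : 0 <= l -> l <= l0 -> `|l| < 3 / 2 * l0.
  by move=> l_ge0 ll0; rewrite ger0_norm// (le_lt_trans ll0)//; move: l0_gt0; lra.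
have F0 : F 0 = 1.
  rewrite /F /Rintegral.
  under eq_integral do rewrite mul0r expR0.
  by rewrite integral_cst//= probability_setT mul1e.
have F10 : F1 0 = fine 'E_P[Z]%E.
  rewrite /F1 /Rintegral unlock; congr fine.
  by apply: eq_integral => w _; rewrite mul0r expR0 mulr1.
pose L l := ln (F l).
have dL l : 0 <= l -> l <= l0 -> is_derive l 1 L ((F l)^-1 * F1 l).
  move=> l_ge0 ll0; have sl := small _ l_ge0 ll0.
  have Fl := F_gt0 (ltW sl).
  apply: (@is_derive1_comp _ (@ln R) F); first exact: is_derive1_ln.
  exact: is_derive_F.
have diff l : 0 < l -> l <= l0 -> l * F1 l - F l * ln (F l) <= A * l ^+ 2 * F l.
  move=> l_gt0 ll0; have sl := small _ (ltW l_gt0) ll0.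
  have := entA _ l_gt0 ll0; rewrite Ent_expR ?(ltW sl)//.
  by rewrite E_EFin ?lee_fin//; exact: (integrable_expR (ltW sl)).
pose K (l : R) : R := L l * l^-1 - A * l.
have dK l : 0 < l -> l <= l0 ->
    is_derive l 1 K ((F l)^-1 * F1 l * l^-1 - L l * l ^- 2 - A).
  move=> l_gt0 ll0.
  have d1 := dL _ (ltW l_gt0) ll0.
  have d2 : is_derive l 1 (fun x : R => x^-1) (- l ^- 2 *: 1).
    exact: (@is_deriveV _ id l 1 1 (lt0r_neq0 l_gt0) (is_derive_id l 1)).
  have d3 : is_derive l 1 (A \*: (id : R -> R)) (A *: 1).
    exact: is_deriveZ.
  have := is_deriveB (is_deriveM d1 d2) d3.
  rewrite (_ : _ - _ = K); last by apply/funext => x.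
  move=> /is_derive_eq; apply.
  by rewrite /GRing.scale /=; ring.
have K_le e : 0 < e -> e <= l0 -> K l0 <= K e.
  move=> e0 el0.
  have H x : x \in `]e, l0[ -> 0 < x /\ x <= l0.
    by rewrite in_itv/= => /andP[ex xl]; rewrite (lt_trans e0)// ltW.
  apply: (@ler0_derive1_le_cc _ K e l0).
  - by move=> x /H[x0 xl]; case: (dK x x0 xl).
  - move=> x /H[x0 xl]; rewrite derive1E; case: (dK x x0 xl) => _ ->.
    have Fx := F_gt0 (ltW (small _ (ltW x0) xl)).
    (* Over a common denominator the derivative of [K] shows the entropy bound [diff] as its
       numerator, which gives the sign. *)
    have -> : (F x)^-1 * F1 x * x^-1 - L x * x ^- 2 - A =
        (x * F1 x - F x * L x - A * x ^+ 2 * F x) / (x ^+ 2 * F x).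
      by field; rewrite !gt_eqF.
    rewrite mulr_le0_ge0 ?invr_ge0 ?mulr_ge0 ?(ltW Fx) ?exprn_ge0 ?(ltW x0)//.
    by rewrite subr_le0; exact: diff.
  - apply: derivable_within_continuous => x.
    rewrite in_itv/= => /andP[ex xl]; have x0 := lt_le_trans e0 ex.
    by case: (dK x x0 xl).
  - by rewrite in_itv/= el0 lexx.
  - by rewrite in_itv/= el0 lexx.
  - exact: el0.
(* Since L(0) = 0, the quotient L(h) / h tends to L'(0) = F'(0) / F(0), which is the mean of [Z]. *)
have K0 : K l0 <= fine 'E_P[Z]%E.
  have := dL 0 (lexx 0) (ltW l0_gt0).
  rewrite F0 invr1 mul1r F10 => -[dL0 DL0].
  have cL : L h * h^-1 @[h --> 0^'+] --> fine 'E_P[Z]%E.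
    apply: cvg_dnbhs_at_right; rewrite -DL0.
    rewrite (_ : (fun h => _) = (fun h : R => h^-1 *: ((L \o shift 0) h%:A - L 0))).
      exact: dL0.
    apply/funext => h /=.
    by rewrite addr0 [h%:A]mulr1 /L F0 ln1 subr0 mulrC.
  have cK : K h @[h --> 0^'+] --> fine 'E_P[Z]%E - A * 0.
    apply: cvgB; first exact: cL.
    apply: cvgM; first exact: cvg_cst.
    by apply: cvg_at_right_filter; exact: cvg_id.
  rewrite -[leRHS]subr0 -(mulr0 A) -(cvg_lim _ cK)//.
  apply: limr_ge; first by apply/cvg_ex; eexists; exact: cK.
  near=> h; apply: K_le.
    by near: h; exact: nbhs_right_gt.
  by near: h; exact: nbhs_right_le.
have sl := small _ (ltW l0_gt0) (lexx _).
have Fl := F_gt0 (ltW sl).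
rewrite E_EFin; last exact: (integrable_expR (ltW sl)).
rewrite lee_fin -[leLHS]lnK ?posrE// ler_expR.
move: K0; rewrite /K lerBlDr ler_pdivrMr// => /le_trans; apply.
by rewrite mulrDl (mulrC _ l0) expr2 mulrA.
Unshelve. all: by end_near. Qed.

(** With the coefficient [t / (2 * l0)] the entropy cost at [l0] is [l0 * t / 2], half of the gain
    [l0 * t] in Chernoff's bound; the other half remains in the exponent. *)
Lemma herbst_tail (t : R) :
  (forall l, 0 < l -> l <= l0 ->
    (Ent P (fun w => expR (l * Z w)) <=
     (t / (2 * l0) * l ^+ 2)%:E * 'E_P[fun w => expR (l * Z w)])%E) ->
  (P [set w | 'E_P[Z] + t%:E <= (Z w)%:E] <= (expR (- (l0 * t / 2)))%:E)%E.
Proof.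
move=> entA; have mgf := herbst_mgf entA.
(* Slope 0 in [integrable_ZexpR]. *)
have intZ : P.-integrable setT (EFin \o Z).
  have := integrable_ZexpR (l := 0); rewrite normr0 => /(_ _).
  under eq_fun do rewrite mul0r expR0 mulr1.
  by apply; rewrite mulr_ge0 ?ltW.
rewrite (E_EFin intZ); set e := (\int[P]_w Z w).
have := chernoff Z (e + t) l0_gt0.
rewrite (_ : [set x | e + t <= Z x] = [set w | (e%:E + t%:E <= (Z w)%:E)%E]); last first.
  by apply/seteqP; split => w /=; rewrite -EFinD lee_fin.
move=> /le_trans; apply.
rewrite /mmt_gen_fun (_ : expR \o l0 \o* Z = fun w => expR (l0 * Z w)); last first.
  by apply/funext => w /=; rewrite mulrC.
apply: (@le_trans _ _ ((expR (l0 * e + t / (2 * l0) * l0 ^+ 2))%:E *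
    (expR (- (l0 * (e + t))))%:E)%E).
  apply: lee_wpmul2r; first by rewrite lee_fin expR_ge0.
  by move: mgf; rewrite (E_EFin intZ).
rewrite -EFinM -expRD lee_fin ler_expR le_eqVlt; apply/orP; left; apply/eqP.
by field; rewrite gt_eqF.
Qed.

End herbst.

(** * Real inequalities behind the two terms of the minimum *)

Section tail_bounds.
Context {R : realType}.

(** Here [u] stands for the l_q norm of the gradient, and the claim makes its q-th power, after
    scaling by [l], fit under the quadratic entropy bound. The left power is at most l (l
    b)^(1/beta). Write l b = (l / l0) (l0 b): since 1/beta >= 1 and l <= l0, the first factor only
    decreases under the power, and 2^beta <= 2 turns the hypothesis into (l0 b)^(1/beta) <= t / (2
    C). *)
Lemma scaled_powR_le (beta C t l0 b l u : R) :
  0 < beta -> beta <= 1 -> 0 < C -> 0 < t -> 0 < l0 -> 0 <= b ->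
  2 * l0 * (C `^ beta * b) <= t `^ beta ->
  0 < l -> l <= l0 -> 0 <= u -> u `^ (1 + beta) <= b ->
  C * (l * u) `^ ((beta + 1) / beta) <= t / (2 * l0) * l ^+ 2.
Proof.
move=> be0 be1 C0 t0 l00 b0 hb l_gt0 ll0 u0 ub.
have iv0 : 0 <= beta^-1 by rewrite invr_ge0 ltW.
have bn0 : beta != 0 by rewrite gt_eqF.
have tC : 0 < t / (2 * C) by rewrite divr_gt0// mulr_gt0.
have lb0 : l0 * b <= (t / (2 * C)) `^ beta.
  have tE : t `^ beta = (t / (2 * C)) `^ beta * (2 `^ beta * C `^ beta).
    rewrite -powRM ?(ltW C0)// -powRM ?(ltW tC) ?mulr_ge0 ?(ltW C0)//.
    by congr (_ `^ _); field; rewrite gt_eqF.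
  have Cb : 0 < C `^ beta by rewrite powR_gt0.
  have two : 2 `^ beta <= 2 :> R.
    by rewrite -[leRHS]powRr1// ler_powR// ler1n.
  have Cb2 : 0 < 2 * C `^ beta by rewrite mulr_gt0.
  rewrite -(ler_pM2l Cb2).
  apply: (@le_trans _ _ (t `^ beta)).
    by rewrite [leLHS](_ : _ = 2 * l0 * (C `^ beta * b))//; ring.
  rewrite tE mulrC ler_wpM2r ?powR_ge0//.
  by rewrite ler_wpM2r// ltW.
have l0b : (l0 * b) `^ beta^-1 <= t / (2 * C).
  rewrite -[leRHS]powRr1 ?(ltW tC)// -[X in _ <= _ `^ X](mulfV bn0) powRrM.
  have l0b_ge0 : 0 <= l0 * b by rewrite mulr_ge0// ltW.
  by apply: ge0_ler_powR; rewrite ?nnegrE ?powR_ge0.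
have lbE : (l * b) `^ beta^-1 <= l / l0 * (t / (2 * C)).
  have -> : l * b = l / l0 * (l0 * b) by field; rewrite gt_eqF.
  have ll : 0 < l / l0 <= 1 by rewrite divr_gt0//= ler_pdivrMr// mul1r.
  have l0b_ge0 : 0 <= l0 * b by rewrite mulr_ge0// ltW.
  rewrite powRM ?divr_ge0 ?(ltW l_gt0) ?(ltW l00)//.
  apply: ler_pM; rewrite ?powR_ge0//.
  rewrite -[leRHS]powRr1; last by rewrite ltW//; case/andP: ll.
  by apply: ger_powR => //; rewrite invf_ge1.
have lu0 : 0 <= l * u by rewrite mulr_ge0// ltW.
have key : (l * u) `^ ((beta + 1) / beta) <= l * (l * b) `^ beta^-1.
  rewrite (addrC beta) powRrM powRM ?(ltW l_gt0)//.
  have -> : l * (l * b) `^ beta^-1 = (l `^ (1 + beta) * b) `^ beta^-1.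
    have -> : l `^ (1 + beta) * b = l `^ beta * (l * b).
      rewrite addrC powRD; last by rewrite (lt0r_neq0 l_gt0) implybT.
      by rewrite powRr1 ?(ltW l_gt0)// mulrA.
    rewrite [RHS]powRM ?powR_ge0 ?mulr_ge0 ?(ltW l_gt0)//.
    by rewrite -powRrM mulfV// powRr1// ltW.
  apply: ge0_ler_powR; rewrite ?nnegrE ?mulr_ge0 ?powR_ge0//.
  by rewrite ler_wpM2l// powR_ge0.
apply: (@le_trans _ _ (C * (l * (l / l0 * (t / (2 * C)))))).
  by rewrite ler_wpM2l ?(ltW C0)// (le_trans key)// ler_wpM2l// ltW.
rewrite le_eqVlt; apply/orP; left; apply/eqP; field.
by rewrite !gt_eqF.
Qed.

Lemma divey_dichotomy (N D : R) : 0 < N -> 0 <= D ->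
  ((N%:E / D%:E = +oo)%E /\ D = 0) \/
  exists r : R, [/\ 0 < r, (N%:E / D%:E = r%:E)%E & r * D = N].
Proof.
move=> N0; rewrite le_eqVlt => /predU1P[<-|D0].
  by left; split => //; rewrite inve0 gt0_muley// lte_fin.
right; exists (N / D); split; first exact: divr_gt0.
  by rewrite inver gt_eqF.
by rewrite divfK// gt_eqF.
Qed.

(** Replaces the extended-real minimum by a positive real [M] under both quotients, from which a
    slope can be built. The conditions on [M] are written as products so that they stay meaningful
    for zero denominators. *)
Lemma le_expeR_min (p : \bar R) (c N1 N2 D1 D2 : R) :
  0 < c -> 0 < N1 -> 0 < N2 -> 0 <= D1 -> 0 <= D2 ->
  (forall M, 0 < M -> M * D1 <= N1 -> M * D2 <= N2 ->
     (p <= (expR (- (c * M)))%:E)%E) ->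
  (p <= expeR (- (c%:E * Order.min (N1%:E / D1%:E) (N2%:E / D2%:E))))%E.
Proof.
move=> c0 N10 N20 D10 D20 H.
have fin r : 0 < r -> r * D1 <= N1 -> r * D2 <= N2 ->
    (p <= expeR (- (c%:E * r%:E)))%E by move=> *; exact: H.
have [[-> D1E]|[r1 [r10 -> r1E]]] := divey_dichotomy N10 D10;
  have [[-> D2E]|[r2 [r20 -> r2E]]] := divey_dichotomy N20 D20.
(* Both denominators vanish: every [M] is admissible and the target is exp(-oo) = 0, so [M] is taken
   large enough to push the bound below a given [e]. *)
- rewrite minxx gt0_muley ?lte_fin//=.
  apply/lee_addgt0Pr => e e0; rewrite add0e.
  pose M := Num.max 1 (- ln e / c).
  have M0 : 0 < M by rewrite lt_max ltr01.
  apply: (le_trans (H M M0 _ _)); rewrite ?D1E ?D2E ?mulr0 ?(ltW N10) ?(ltW N20)//.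
  rewrite lee_fin -[leRHS]lnK ?posrE// ler_expR lerNl.
  by rewrite mulrC -ler_pdivrMr// /M le_max lexx orbT.
- rewrite min_r ?leey//; apply: fin => //; last by rewrite r2E.
  by rewrite D1E mulr0 ltW.
- rewrite min_l ?leey//; apply: fin => //; first by rewrite r1E.
  by rewrite D2E mulr0 ltW.
- rewrite -EFin_min; apply: fin; first by rewrite lt_min r10.
    by rewrite -r1E ler_wpM2r// ge_min lexx.
  by rewrite -r2E ler_wpM2r// ge_min lexx orbT.
Qed.

End tail_bounds.

(** * Concentration of a smooth function of the random vector *)

Section concentration.
Context {d : measure_display} {T : measurableType d} {R : realType}
  (P : probability T R).

(** Takes a pointwise bound on the gradient factor [g] out of the expectation, which brings the
    log-Sobolev inequality to the form that [herbst_tail] expects. *)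
Lemma Ent_le_mul (g Y : T -> R) (C M : R) :
  measurable_fun setT g -> measurable_fun setT Y ->
  (forall w, 0 <= Y w) -> (forall w, 0 <= g w) -> 0 <= C -> 0 <= M ->
  (forall w, C * g w <= M) ->
  (Ent P Y <= C%:E * 'E_P[fun w => (g w * Y w)%R])%E ->
  (Ent P Y <= M%:E * 'E_P[Y])%E.
Proof.
move=> mg mY Y0 g0 C0 M0 gM /le_trans; apply.
rewrite unlock -ge0_integralZl_EFin//; last 2 first.
- by move=> w _; rewrite lee_fin mulr_ge0.
- by apply/measurable_EFinP; exact: measurable_funM.
rewrite -ge0_integralZl_EFin//; last 2 first.
- by move=> w _; rewrite lee_fin.
- exact/measurable_EFinP.
apply: ge0_le_integral => //.
- by move=> w _; rewrite -EFinM lee_fin !mulr_ge0.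
- by apply/measurable_EFinP; apply: measurable_funM => //; exact: measurable_funM.
- by apply/measurable_EFinP; exact: measurable_funM.
- by move=> w _; rewrite -!EFinM lee_fin mulrA ler_wpM2r.
Qed.

Variables (n : nat) (X : 'I_n -> {RV P >-> R}) (phi : 'rV[R]_n -> R).
Variables (beta m sigma : R).
Hypotheses (beta_ge0 : 0 <= beta) (m_gt0 : 0 < m) (sigma_ge0 : 0 <= sigma).
Hypothesis indX : mutually_independent X.
Hypothesis tailX : forall i,
  tail_class beta m (sigma `^ (beta + 1)) (distribution P (X i)).
Hypothesis smooth_phi : smooth phi.

(** By [partial_le_norm_sub_sum], |phi(X)| is at most |phi(0)| plus [B] times the sum of the |X_i|,
    whose exponential moment at slope [l * B] is finite. *)
Lemma integrable_expR_norm_rvec (l B : R) : 0 <= l -> 0 <= B ->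
  (forall i x, `|partial i phi x| <= B) ->
  (beta = 0 -> l * B * (m + 3 * sigma) <= 1) ->
  P.-integrable setT (fun w => (expR (l * `|phi (rvec X w)|))%:E).
Proof.
move=> l0 B0 phiB lB.
have [h [K [h0 ah K0 tl]]] :=
  tail_class_geometric_step beta_ge0 m_gt0 sigma_ge0 (mulr_ge0 l0 B0) lB.
have tlX i k : fine (P [set w | h *+ k <= `|X i w|]) <= K * 3 ^- k.
  exact: (tl _ (tailX i) k).
have lty := expR_sum_norm_lty indX h0 (mulr_ge0 l0 B0) ah K0 tlX.
have mS := measurable_expR_sum_norm X (l * B).
have intS : P.-integrable setT (EFin \o
    (fun w => expR (l * `|phi 0|) * expR (l * B * \sum_i `|X i w|))).
  have H : P.-integrable setT (EFin \o (fun w => expR (l * B * \sum_i `|X i w|))).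
    apply/integrableP; split; first exact/measurable_EFinP.
    under eq_integral do rewrite /= (ger0_norm (expR_ge0 _)).
    exact: lty.
  exact: (integrableZl measurableT (expR (l * `|phi 0|)) H).
apply: le_integrable intS => //.
  apply/measurable_EFinP; apply: measurableT_comp => //.
  apply: measurable_funM => //; apply: measurableT_comp => //.
  by apply: measurable_continuous_rvec; exact: smooth_continuous.
move=> w _ /=; rewrite lee_fin -expRD !(ger0_norm (expR_ge0 _)) ler_expR.
rewrite -mulrA -mulrDr ler_wpM2l//.
have dphi i x := (smooth_phi [::]).1 i x.
have := partial_le_norm_sub_sum dphi phiB (rvec X w).
rewrite (eq_bigr (fun i => `|X i w|)); last by move=> i _; rewrite mxE.
by move=> H; rewrite -lerBlDl (le_trans _ H)// lerB_dist.
Qed.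

(** Common core of both cases: [g l] is the gradient term of the log-Sobolev inequality for the
    function [l] times [phi]. The factor 2 in the condition for [beta = 0] comes from the
    integrability at slope [2 * l0] required by [herbst_tail]. *)
Lemma rvec_tail (l0 t B : R) (g : R -> 'rV[R]_n -> R) (C : R) :
  0 < l0 -> 0 <= t -> 0 <= B -> 0 <= C ->
  (forall i x, `|partial i phi x| <= B) ->
  (beta = 0 -> 2 * l0 * B * (m + 3 * sigma) <= 1) ->
  (forall l, measurable_fun setT (fun w => g l (rvec X w))) ->
  (forall l x, 0 <= g l x) ->
  (forall l x, 0 < l -> l <= l0 -> C * g l x <= t / (2 * l0) * l ^+ 2) ->
  (forall l, 0 < l -> l <= l0 ->
    (Ent P (fun w => expR (l * phi (rvec X w))) <=
     C%:E * 'E_P[fun w => (g l (rvec X w) * expR (l * phi (rvec X w)))%R])%E) ->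
  (P [set w | 'E_P[fun w' => phi (rvec X w')] + t%:E <= (phi (rvec X w))%:E]
    <= (expR (- (l0 * t / 2)))%:E)%E.
Proof.
move=> l00 t0 B0 C0 phiB lB mg g0 gM ent.
have mZ : measurable_fun setT (fun w => phi (rvec X w)).
  by apply: measurable_continuous_rvec; exact: smooth_continuous.
pose Z : {RV P >-> R} := mfun_Sub (mem_set mZ).
apply: (@herbst_tail _ _ _ P Z l0 l00).
  by apply: (integrable_expR_norm_rvec (B := B)) => //; rewrite mulr_ge0// ltW.
move=> l l_gt0 ll0.
apply: (Ent_le_mul (g := fun w => g l (rvec X w)) (C := C)) => //.
- by apply: measurableT_comp => //; exact: measurable_funM.
- by rewrite mulr_ge0 ?sqr_ge0// divr_ge0// mulr_ge0// ltW.
- by move=> w; exact: gM.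
- exact: ent.
Qed.

End concentration.

(* Quotients are taken in \bar R, where t / 0 = +oo for t > 0, 0 / 0 = 0 and
   expeR (- +oo) = 0; this only matters when grad phi vanishes identically. *)
Theorem corollary1p6 (R : realType) (beta m sigma C : R)
  (hbeta0 : 0 <= beta) (hbeta1 : beta <= 1) (hm : 0 < m) (hsigma : 0 <= sigma)
  (hC : mlsi_constant beta m sigma C)
  (n : nat) (hn : (0 < n)%N)
  (d : measure_display) (T : measurableType d) (P : probability T R)
  (X : 'I_n -> {RV P >-> R})
  (hindep : mutually_independent X)
  (hX : forall i,
    tail_class beta m (sigma `^ (beta + 1)) (distribution P (X i)))
  (phi : 'rV[R]_n -> R)
  (hsmooth : smooth phi) (hconvex : convex_function setT phi)
  (hlip : lipschitz phi) :
  (0 < beta -> forall t : R, 0 <= t ->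
    let q := (beta + 1) / beta in
    (P [set w | 'E_P[fun w' => phi (rvec X w')] + t%:E
                <= (phi (rvec X w))%:E] <=
     expeR (- ((3 / 16)%R%:E * Order.min
       ((t ^+ 2)%R%:E / (C%:E * supE (fun x => (l2norm (grad phi x) ^+ 2)%R)))
       ((t `^ (1 + beta))%R%:E /
        ((C `^ beta)%R%:E *
         supE (fun x => (lpnorm q (grad phi x) `^ (1 + beta))%R))))))%E) /\
  (beta = 0 -> forall t : R, 0 <= t ->
    (P [set w | 'E_P[fun w' => phi (rvec X w')] + t%:E
                <= (phi (rvec X w))%:E] <=
     expeR (- ((1 / 4)%R%:E * Order.min
       ((t ^+ 2)%R%:E / (C%:E * supE (fun x => (l2norm (grad phi x) ^+ 2)%R)))
       (t%:E / ((m + 3 * sigma)%R%:E *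
                supE (fun x => `|grad phi x|%R))))))%E).

Proof.
have [C0 mlsi] := hC.
(* This crude bound makes every supremum in the statement finite; they become the reals [a] and [b]
   below. *)
have [L [L0 Lphi]] := lipschitz_partial_le hsmooth hlip.
(* The case [t = 0]: both numerators vanish, so the exponent is 0 and the bound is 1. *)
have trivial_bound (c y : \bar R) : (y = 0)%E ->
    (P [set w | 'E_P[fun w' => phi (rvec X w')] + 0%:E <= (phi (rvec X w))%:E]
     <= expeR (- (c * y)))%E.
  move=> ->; rewrite mule0 oppe0 expeR0; apply: probability_le1.
  have mZ : measurable_fun setT (fun w => phi (rvec X w)).
    by apply: measurable_continuous_rvec; exact: smooth_continuous.
  rewrite -[X in measurable X]setTI.
  apply: (measurable_fun_lee (D := setT)) => //.
  exact/measurable_EFinP.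
have gphi (i : 'I_n) x : `|grad phi x ord0 i| <= L by rewrite mxE.
have [a [aE a0 ga]] : exists a : R,
    [/\ supE (fun x => l2norm (grad phi x) ^+ 2) = a%:E, 0 <= a &
        forall x, l2norm (grad phi x) ^+ 2 <= a].
  apply: (supE_fin_num (M := ((n%:R * L `^ 2) `^ 2^-1) ^+ 2)) => x.
  rewrite sqr_ge0/= lerXn2r ?nnegrE ?lpnorm_ge0 ?powR_ge0//.
  by apply: lpnorm_le.
have entS l : 0 < l -> 
   smooth (l \*: phi) /\ convex_function setT (l \*: phi).
  by move=> l0; split; [exact: smoothZ|apply: convex_functionZ => //; exact: ltW].
split=> [beta_gt0 t|beta0 t].
- rewrite le_eqVlt => /predU1P[<-|t0] /=.
    by apply: trivial_bound; rewrite expr0n/= powR0 ?gt_eqF ?ltr_wpDr// !mul0e minxx.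
  set q := (beta + 1) / beta.
  have q0 : 0 < q by rewrite divr_gt0// ltr_wpDl.
  have [b [bE b0 gb]] : exists b : R,
      [/\ supE (fun x => lpnorm q (grad phi x) `^ (1 + beta)) = b%:E, 0 <= b &
          forall x, lpnorm q (grad phi x) `^ (1 + beta) <= b].
    apply: (supE_fin_num (M := ((n%:R * L `^ q) `^ q^-1) `^ (1 + beta))) => x.
    rewrite powR_ge0/=; apply: ge0_ler_powR; rewrite ?nnegrE ?lpnorm_ge0 ?powR_ge0//.
      by rewrite addr_ge0.
    exact: lpnorm_le.
  rewrite aE bE -!EFinM.
  apply: le_expeR_min => //.
  - by rewrite exprn_gt0.
  - by rewrite powR_gt0.
  - by rewrite mulr_ge0// ltW.
  - by rewrite mulr_ge0// powR_ge0.
  move=> M M0 Ma Mb.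
  (* The largest slope that the quadratic term permits: [t / (2 * l0)] equals [t ^+ 2 / M], which by
     [Ma] is at least [C * a]. *)
  pose l0 := M / (2 * t).
  have l00 : 0 < l0 by rewrite divr_gt0// mulr_gt0.
  (* The exponent obtained is M / 4, which exceeds 3 M / 16. *)
  apply: (@le_trans _ _ (expR (- (l0 * t / 2)))%:E); last first.
    rewrite lee_fin ler_expR lerN2 (_ : l0 * t / 2 = M / 4); last first.
      by rewrite /l0; field; rewrite gt_eqF.
    by rewrite mulrC ler_pM2l//; lra.
  apply: (rvec_tail hbeta0 hm hsigma hindep hX hsmooth (B := L) (C := C)
    (g := fun l x => Num.max (l2norm (grad (l \*: phi) x) ^+ 2)
                  (lpnorm q (grad (l \*: phi) x) `^ q))) => //.
  + exact: ltW.
  + exact: ltW.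
  + by move=> be0; move: beta_gt0; rewrite be0 ltxx.
  + move=> l; apply: measurable_maxr.
      apply: measurable_funX; apply: measurable_lpnorm_grad.
      exact: smoothZ.
    apply: (measurableT_comp (measurable_powR _)).
    by apply: measurable_lpnorm_grad; exact: smoothZ.
  + by move=> l x; rewrite le_max sqr_ge0.
  + move=> l x l_gt0 ll0.
    rewrite gradZ// /l2norm !lpnormZ ?(ltW l_gt0) ?(gt_eqF q0)// maxr_pMr ?(ltW C0)// ge_max.
    apply/andP; split.
      rewrite exprMn mulrCA mulrC ler_wpM2r ?sqr_ge0//.
      apply: (@le_trans _ _ (C * a)); first by rewrite ler_wpM2l ?(ltW C0)// ga.
      rewrite (_ : t / (2 * l0) = t ^+ 2 / M); first by rewrite ler_pdivlMr// mulrC.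
      by rewrite /l0; field; rewrite !gt_eqF.
    apply: (scaled_powR_le _ _ _ _ l00 b0) => //; last exact: lpnorm_ge0.
    (* Multiplied by [t], the condition on [l0] is exactly [Mb]. *)
    rewrite -(ler_pM2l t0) (_ : t * t `^ beta = t `^ (1 + beta)); last first.
      by rewrite powRD ?powRr1 ?(ltW t0)// (lt0r_neq0 t0) implybT.
    apply: le_trans Mb; rewrite le_eqVlt; apply/orP; left; apply/eqP.
    by rewrite /l0; field; rewrite gt_eqF.
  + move=> l l_gt0 ll0; have [sl cl] := entS _ l_gt0.
    exact: (mlsi n d T P X _ hn hindep hX sl cl).1.
- rewrite le_eqVlt => /predU1P[<-|t0] /=.
    by apply: trivial_bound; rewrite expr0n/= !mul0e minxx.
  have [b [bE b0 gb]] : exists b : R, [/\ supE (fun x => `|grad phi x|) = b%:E, 0 <= b &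
          forall x, `|grad phi x| <= b].
    apply: (supE_fin_num (M := L)) => x.
    rewrite normr_ge0/= [X in X <= _]mx_normrE; apply: bigmax_le => // -[j i] _ /=.
    by rewrite (ord1 j).
  have ms0 : 0 < m + 3 * sigma by rewrite ltr_wpDr// mulr_ge0.
  have pb (i : 'I_n) x : `|partial i phi x| <= b.
    apply: le_trans (gb x); rewrite [leRHS]mx_normrE.
    by apply: le_trans (le_bigmax _ _ (ord0, i)); rewrite /= mxE.
  rewrite aE bE -!EFinM.
  apply: le_expeR_min => //.
  - by rewrite exprn_gt0.
  - by rewrite mulr_ge0// ltW.
  - by rewrite mulr_ge0// ltW.
  move=> M M0 Ma Mb.
  pose l0 := M / (2 * t).
  have l00 : 0 < l0 by rewrite divr_gt0// mulr_gt0.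
  (* The linear term of the minimum enters here. This one inequality gives both integrability at
     slope [2 * l0] and, for [l <= l0], the bound on partial derivatives under which the log-Sobolev
     inequality holds when [beta = 0]. *)
  have lb : 2 * l0 * b * (m + 3 * sigma) <= 1.
    rewrite (_ : _ * _ = M * ((m + 3 * sigma) * b) / t); last first.
      by rewrite /l0; field; rewrite gt_eqF.
    by rewrite ler_pdivrMr// mul1r.
  apply: (@le_trans _ _ (expR (- (l0 * t / 2)))%:E); last first.
    rewrite lee_fin ler_expR lerN2 (_ : l0 * t / 2 = 1 / 4 * M)//.
    by rewrite /l0; field; rewrite gt_eqF.
  apply: (rvec_tail hbeta0 hm hsigma hindep hX hsmooth (B := b) (C := C)
    (g := fun l x => l2norm (grad (l \*: phi) x) ^+ 2)) => //.
  + exact: ltW.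
  + exact: ltW.
  + move=> l; apply: measurable_funX; apply: measurable_lpnorm_grad.
    exact: smoothZ.
  + by move=> l x; rewrite sqr_ge0.
  + move=> l x l_gt0 ll0.
    rewrite gradZ// /l2norm lpnormZ ?(ltW l_gt0)//.
    rewrite exprMn mulrCA mulrC ler_wpM2r ?sqr_ge0//.
    apply: (@le_trans _ _ (C * a)); first by rewrite ler_wpM2l ?(ltW C0)// ga.
    rewrite (_ : t / (2 * l0) = t ^+ 2 / M); first by rewrite ler_pdivlMr// mulrC.
    by rewrite /l0; field; rewrite !gt_eqF.
  + move=> l l_gt0 ll0; have [sl cl] := entS _ l_gt0.
    apply: (mlsi n d T P X _ hn hindep hX sl cl).2 => // i x.
    rewrite partialZ; last by move=> y; exact: (hsmooth [::]).1.
    rewrite [X in `|X|](_ : _ = l * partial i phi x)// normrM (gtr0_norm l_gt0).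
    rewrite ler_pdivlMr ?mulr_gt0// (le_trans _ lb)//.
    rewrite (_ : 2 * l0 * b * _ = l0 * b * (2 * (m + 3 * sigma))); last by ring.
    by rewrite ler_wpM2r ?mulr_ge0 ?(ltW ms0)// ler_pM// ltW.
Qed.
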